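(* Let $\Sigma=(X,\mathcal{D},\phi)$ be a system that is robustly forward complete and for which $0$ is a robust equilibrium point. If there exists a non-coercive Lyapunov function $V$ for $\Sigma$, then $0$ is uniformly globally asymptotically stable (UGAS) for $\Sigma$.
   Context: Notation: $\mathbb{R}_+=[0,\infty)$. $\mathcal{K}$ is the set of continuous strictly increasing $\gamma:\mathbb{R}_+\to\mathbb{R}_+$ with $\gamma(0)=0$; $\mathcal{K}_\infty$ is the set of unbounded $\gamma\in\mathcal{K}$; $\mathcal{L}$ is the set of continuous decreasing $\gamma:\mathbb{R}_+\to\mathbb{R}_+$ with $\lim_{t\to\infty}\gamma(t)=0$; $\mathcal{KL}$ is the set of $\beta:\mathbb{R}_+^2\to\mathbb{R}_+$ with $\beta(\cdot,t)\in\mathcal{K}$ for all $t\ge0$ and $\beta(r,\cdot)\in\mathcal{L}$ for all $r>0$. System: A (forward complete dynamical) system $\Sigma=(X,\mathcal{D},\phi)$ consists of a normed linear space $(X,\|\cdot\|_X)$, a set $D$ of disturbance values (a nonempty subset of a normed linear space), a set $\mathcal{D}$ of functions $d:\mathbb{R}_+\to D$, and a map $\phi:\mathbb{R}_+\times X\times\mathcal{D}\to X$ (defined everywhere). $\mathcal{D}$ is shift-invariant ($d\in\mathcal{D}$, $\tau\ge0$ imply $d(\cdot+\tau)\in\mathcal{D}$) and closed under concatenation (for $d_1,d_2\in\mathcal{D}$, $t>0$, the function equal to $d_1(\tau)$ for $\tau\in[0,t]$ and $d_2(\tau-t)$ for $\tau>t$ is in $\mathcal{D}$). Moreover: $\phi(0,x,d)=x$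 for all $x,d$; causality: if $d(s)=\tilde d(s)$ for all $s\in[0,t]$ then $\phi(t,x,d)=\phi(t,x,\tilde d)$; for each $(x,d)$ the map $t\mapsto\phi(t,x,d)$ is continuous; cocycle property: $\phi(h,\phi(t,x,d),d(t+\cdot))=\phi(t+h,x,d)$ for all $t,h\ge0$, $x\in X$, $d\in\mathcal{D}$. Robustly forward complete (RFC): for all $C>0,\tau>0$, $\sup\{\|\phi(t,x,d)\|_X : \|x\|_X\le C,\ t\in[0,\tau],\ d\in\mathcal{D}\}<\infty$. Robust equilibrium point: $\phi(t,0,d)=0$ for all $t\ge0,d\in\mathcal{D}$, and for all $\varepsilon>0,h>0$ there is $\delta>0$ such that $\|x\|_X\le\delta$, $t\in[0,h]$, $d\in\mathcal{D}$ imply $\|\phi(t,x,d)\|_X\le\varepsilon$. Non-coercive Lyapunov function: a continuous $V:X\to\mathbb{R}_+$ with $V(0)=0$ for which there exist $\psi_2\in\mathcal{K}_\infty$ and $\alpha\in\mathcal{K}$ such that $0<V(x)\le\psi_2(\|x\|_X)$ for all $x\in X\setminus\{0\}$, and $\dot V_d(x):=\liminf_{t\to+0}\frac1t\big(V(\phi(t,x,d))-V(x)\big)\le-\alpha(\|x\|_X)$ for all $x\in X$, $d\in\mathcal{D}$. UGAS: there is $\beta\in\mathcal{KL}$ with $\|\phi(t,x,d)\|_X\le\beta(\|x\|_X,t)$ for all $x\in X$, $d\in\mathcal{D}$, $t\ge0$. *)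

(* Defs.v *)
From HB Require Import structures.
From mathcomp Require Import all_boot all_order all_algebra.
From mathcomp Require Import all_classical all_reals all_analysis.
Import Order.TTheory GRing.Theory Num.Theory.
Import numFieldNormedType.Exports.

Set Implicit Arguments.
Unset Strict Implicit.
Unset Printing Implicit Defensive.

Local Open Scope classical_set_scope.
Local Open Scope ring_scope.

(* Functions with domain [0, +oo[ are represented by functions on R; every
   condition below constrains them on [0, +oo[ only. *)

Section comparison_functions.
Context {R : realType}.
Implicit Types (gamma : R -> R) (beta : R -> R -> R).

Definition classK gamma : Prop :=
  [/\ {within `[0, +oo[, continuous gamma},
      forall r : R, 0 <= r -> 0 <= gamma r,
      forall r s : R, 0 <= r -> r < s -> gamma r < gamma s
    & gamma 0 = 0].

Definition classKoo gamma : Prop :=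
  classK gamma /\ forall M : R, exists2 r : R, 0 <= r & M < gamma r.

(* "Decreasing" is read strictly. *)
Definition classL gamma : Prop :=
  [/\ {within `[0, +oo[, continuous gamma},
      forall t : R, 0 <= t -> 0 <= gamma t,
      forall s t : R, 0 <= s -> s < t -> gamma t < gamma s
    & gamma t @[t --> +oo] --> 0].

Definition classKL beta : Prop :=
  (forall t : R, 0 <= t -> classK (fun r => beta r t)) /\
  (forall r : R, 0 < r -> classL (fun t => beta r t)).

End comparison_functions.

Section disturbance_operations.
Context {R : realType} {U : Type}.

Definition shift_dist (tau : R) (d : R -> U) : R -> U := fun s => d (s + tau).

Definition concat_dist (t : R) (d1 d2 : R -> U) : R -> U :=
  fun s => if s <= t then d1 s else d2 (s - t).

End disturbance_operations.

(* [flow] is a total function, but its values are constrained (and used) only at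
   nonnegative times and at disturbances in [dist].  By [flow_causal], such a
   value depends only on the restriction of the disturbance to [0, +oo[. *)
Record system (R : realType) (X U : normedModType R) := System {
  dist_values : set U;
  dist : set (R -> U);
  flow : R -> X -> (R -> U) -> X;
  dist_values_neq0 : dist_values !=set0;
  dist_valued : forall d (t : R), dist d -> 0 <= t -> dist_values (d t);
  dist_shift : forall d (tau : R), dist d -> 0 <= tau -> dist (shift_dist tau d);
  dist_concat : forall d1 d2 (t : R), dist d1 -> dist d2 -> 0 < t ->
    dist (concat_dist t d1 d2);
  flow0 : forall x d, dist d -> flow 0 x d = x;
  flow_causal : forall (t : R) x d d', dist d -> dist d' -> 0 <= t ->
    (forall s : R, 0 <= s <= t -> d s = d' s) -> flow t x d = flow t x d';
  flow_continuous : forall x d, dist d ->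
    {within `[0, +oo[, continuous (fun t : R => flow t x d)};
  flow_cocycle : forall (t h : R) x d, dist d -> 0 <= t -> 0 <= h ->
    flow h (flow t x d) (shift_dist t d) = flow (t + h) x d
}.

Section stability.
Context {R : realType} {X U : normedModType R}.
Variable S : system X U.

Definition robustly_forward_complete : Prop :=
  forall C tau : R, 0 < C -> 0 < tau ->
  let reached := [set r : R | exists (x : X) (t : R) (d : R -> U),
    [/\ `|x| <= C, 0 <= t <= tau, dist S d & r = `|flow S t x d|]] in
  (ereal_sup (EFin @` reached) < +oo)%E.

Definition robust_equilibrium0 : Prop :=
  (forall (t : R) d, 0 <= t -> dist S d -> flow S t 0 d = 0) /\
  (forall eps h : R, 0 < eps -> 0 < h -> exists2 delta : R, 0 < delta &
     forall (x : X) (t : R) d, `|x| <= delta -> 0 <= t <= h -> dist S d ->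
       `|flow S t x d| <= eps).

Definition lower_dini (V : X -> R) (d : R -> U) (x : X) : \bar R :=
  limf_einf (fun t : R => (t^-1 * (V (flow S t x d) - V x))%:E) 0^'+.

Definition noncoercive_lyapunov (V : X -> R) : Prop :=
  [/\ continuous V, forall x, 0 <= V x, V 0 = 0
    & exists psi2 alpha : R -> R,
      [/\ classKoo psi2, classK alpha,
          forall x : X, x != 0 -> 0 < V x <= psi2 `|x|
        & forall (x : X) d, dist S d ->
            (lower_dini V d x <= (- alpha `|x|)%:E)%E]].

Definition UGAS0 : Prop :=
  exists2 beta : R -> R -> R, classKL beta &
    forall (x : X) d (t : R), dist S d -> 0 <= t -> `|flow S t x d| <= beta `|x| t.

End stability.

(* Main.v *)
Require Import Defs.
From mathcomp Require Import all_boot all_order all_algebra.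
From mathcomp Require Import all_classical all_reals all_analysis.
From mathcomp Require Import ring lra.
Import Order.TTheory GRing.Theory Num.Theory.
Import numFieldNormedType.Exports.

(** Along a trajectory V decreases, and at rate at least alpha eps while the norm
    stays above eps; but V is only positive, so a small value of V says nothing
    about the norm. Stability must therefore come from the time that an excursion
    takes rather than from sublevel sets of V.

    - Decay in integrated form ([lyapunov_decay]). A continuous function whose
      lower right Dini derivative is negative everywhere is nonincreasing
      ([nonincreasing_of_descent]); applied to s |-> V (phi s) + c' s, this turns
      the pointwise bound on the derivative into V (phi t) <= V (phi s) - c (t - s)
      on every time interval on which alpha |phi| >= c.
    - Trajectories starting in a given ball enter any smaller ball within a uniform
      time, since otherwise V would become negative
      ([uniform_weak_attractivity]).
    - Trajectories starting close enough to 0 stay close to 0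
      ([uniform_stability]). A trajectory that reaches norm eps has spent the whole
      preceding unit of time outside some del-ball, by robustness of the
      equilibrium, and so has consumed at least alpha del of V, which is not
      available near 0 because V is continuous with V 0 = 0.
    - Once in the small ball the trajectory stays near 0, hence attraction is
      uniform ([uniform_attractivity]); robust forward completeness bounds the
      trajectories before that time ([uniform_boundedness]).

    These uniform estimates amount to a bound of class KL ([KL_majorant]). It is a
    supremum over all trajectories of their norms weighted by Lipschitz cut-offs in
    the initial norm and in time, which makes the supremum continuous and monotone
    in either variable, plus a term that makes the monotonicity strict. *)

Set Implicit Arguments.
Unset Strict Implicit.

Local Open Scope classical_set_scope.
Local Open Scope ring_scope.

(** * Continuity on the half-line and Dini derivatives *)

Lemma within_half_line_continuousP {R : realType} {W : normedModType R}
    (f : R -> W) :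
  {within `[0, +oo[, continuous f} <->
  forall x : R, 0 <= x -> forall e : R, 0 < e -> exists2 del : R, 0 < del &
    forall y : R, 0 <= y -> `|y - x| < del -> `|f x - f y| < e.
Proof.
split=> [/subspace_continuousP cf x x0 e e0|cf].
  have : `[0, +oo[%classic x by rewrite /= in_itv/= x0.
  move=> /cf/cvgrPdist_lt/(_ e e0); rewrite near_withinE => /nbhs_ballP.
  move=> [del /= del0 fdel]; exists del => // y y0 yx; apply: (fdel y) => //=.
    by rewrite /ball/= distrC.
  by rewrite /= in_itv/= y0.
apply/subspace_continuousP => x /=; rewrite in_itv/= andbT => x0.
apply/cvgrPdist_lt => e e0; rewrite near_withinE; apply/nbhs_ballP.
have [del del0 fdel] := cf x x0 e e0; exists del => //= y.
by rewrite /ball/= distrC in_itv/= andbT => yx y0; exact: fdel.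
Qed.

(** A lower limit below c only says that values below c are taken arbitrarily
    close to 0, at times that need not form a neighbourhood; this is all that the
    descent argument below uses. *)
Lemma limf_einf_right_lt {R : realType} (f : R -> R) (l c del : R) :
  (limf_einf (fun t => (f t)%:E) 0^'+ <= l%:E)%E -> l < c -> 0 < del ->
  exists2 t, 0 < t < del & f t < c.
Proof.
move=> fl lc del0; apply: contrapT => fc.
suff : (c%:E <= limf_einf (fun t => (f t)%:E) 0^'+)%E.
  by move=> /le_trans/(_ fl); rewrite lee_fin leNgt lc.
rewrite /limf_einf/= leeNr.
pose V : set R := [set t | 0 < t < del].
apply: ge_ereal_inf; exists (ereal_sup [set (- (f t)%:E)%E | t in V]).
  exists V => //; rewrite /V.
  apply: filterS2 (nbhs_right_gt _) (nbhs_right_lt del0).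
  by move=> t /= -> ->.
apply: ge_ereal_sup => _ [t tV <-]; rewrite leeN2 lee_fin leNgt.
by apply/negP => ftc; apply: fc; exists t.
Qed.

(** The times in the interval from a to b at which h is at most h a form a closed
    set, whose largest element can only be b: any earlier one would be followed by
    a time at which h is smaller still. *)
Lemma nonincreasing_of_descent {R : realType} (h : R -> R) (a b : R) :
  0 <= a -> a <= b -> {within `[0, +oo[, continuous h} ->
  (forall s, a <= s < b -> forall del, 0 < del ->
     exists2 t, 0 < t < del & h (s + t) < h s) ->
  h b <= h a.
Proof.
move=> a0 ab /within_half_line_continuousP ch desc; rewrite leNgt.
apply/negP => hab.
pose A : set R := [set s | a <= s <= b /\ h s <= h a].
have Aa : A a by split=> //; rewrite lexx.
have ubA : has_ubound A by exists b => s [/andP[]].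
pose c := sup A.
have ac : a <= c by exact: ub_le_sup.
have cb : c <= b by apply: ge_sup; [exists a|move=> s [/andP[]]].
have c0 : 0 <= c by exact: le_trans ac.
have hca : h c <= h a.
  rewrite leNgt; apply/negP => hac.
  have [|del del0 hdel] := ch c c0 (h c - h a); first by rewrite subr_gt0.
  have [|s [/andP[as_ sb] hs] cs] := sup_adherent del0 (E := A).
    by split; [exists a|].
  have sc : s <= c by apply: ub_le_sup => //; split=> //; rewrite as_.
  have := hdel s (le_trans a0 as_).
  rewrite ler0_norm ?subr_le0// opprB ltrBlDr -ltrBlDl => /(_ cs).
  by move=> /(le_lt_trans (ler_norm _)); lra.
have {}cb : c < b.
  by rewrite lt_neqAle cb andbT; apply: contraTneq hab => <-; rewrite -leNgt.
have [||t /andP[t0 tb] hct] := desc c _ (b - c).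
- by rewrite ac.
- by rewrite subr_gt0.
have : c + t <= c.
  by apply: ub_le_sup => //; split; [apply/andP; split|]; lra.
lra.
Qed.

(** * Decay of a non-coercive Lyapunov function *)

Section lyapunov.
Context {R : realType} {X U : normedModType R} (S : system X U).

(** By the cocycle property the pointwise bound on the lower Dini derivative
    holds at every time of the trajectory, so s |-> V (phi s) + c' s has negative
    lower derivative for each c' < c. With c = 0 this is the monotonicity of V along
    trajectories. *)
Lemma lyapunov_decay (V : X -> R) (alpha : R -> R) (c : R) (x : X) d (s t : R) :
  continuous V ->
  (forall y e, dist S e -> (lower_dini S V e y <= (- alpha `|y|)%:E)%E) ->
  dist S d -> 0 <= s -> s <= t ->
  (forall u, s <= u < t -> c <= alpha `|flow S u x d|) ->
  V (flow S t x d) <= V (flow S s x d) - c * (t - s).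
Proof.
move=> cV dV Dd s0 st calpha.
suff decay c' : c' < c ->
    V (flow S t x d) <= V (flow S s x d) - c' * (t - s).
  (* The slope is lowered by e / (t - s + 1), which costs at most e over a time
     t - s, also when t = s. *)
  apply/ler_addgt0Pr => e e0.
  have ts : 0 < t - s + 1 by lra.
  have /decay : c - e / (t - s + 1) < c by rewrite ltrBlDr ltrDl divr_gt0.
  move=> /le_trans; apply.
  have : e / (t - s + 1) * (t - s) <= e.
    by rewrite mulrAC ler_pdivrMr//; nra.
  by rewrite mulrBl; lra.
move=> c'c.
suff : V (flow S t x d) + c' * t <= V (flow S s x d) + c' * s.
  by rewrite mulrBr; lra.
apply: (@nonincreasing_of_descent _ (fun u => V (flow S u x d) + c' * u)) => //.
  have cVf : {within `[0, +oo[, continuous (V \o fun u => flow S u x d)}.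
    have cf := @flow_continuous _ _ _ S x d Dd.
    by move=> u; apply: (continuous_comp (cf u)); exact: cV.
  have cl : {within `[0, +oo[, continuous (fun u : R => c' * u)}.
    by apply: continuous_subspaceT => u; exact: mulrl_continuous.
  by move=> u; apply: (continuousD (cVf u)); exact: cl.
move=> u sut del del0.
have u0 : 0 <= u by move: sut => /andP[/(le_trans s0)].
have Dud : dist S (shift_dist u d) by exact: dist_shift.
have ac' : - alpha `|flow S u x d| < - c'.
  by rewrite ltrN2 (lt_le_trans c'c)// calpha.
have [h /andP[h0 hdel]] := limf_einf_right_lt (dV _ _ Dud) ac' del0.
rewrite mulrC ltr_pdivrMr// flow_cocycle ?(ltW h0)// => Vh.
by exists h; [rewrite h0|rewrite mulrDr; lra].
Qed.

Lemma classK_gt0 (gamma : R -> R) (r : R) : classK gamma -> 0 < r -> 0 < gamma r.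
Proof. by move=> [_ _ gammai gamma0] r0; rewrite -gamma0 gammai. Qed.

Lemma classK_le (gamma : R -> R) (r s : R) :
  classK gamma -> 0 <= r -> r <= s -> gamma r <= gamma s.
Proof.
move=> [_ _ gammai _] r0; rewrite le_eqVlt => /predU1P[->//|rs].
exact/ltW/gammai.
Qed.

(** * Stability and attractivity *)

Lemma flow_cocycleB (x : X) d (s t : R) : dist S d -> 0 <= s -> s <= t ->
  flow S t x d = flow S (t - s) (flow S s x d) (shift_dist s d).
Proof.
by move=> Dd s0 st; rewrite flow_cocycle ?subr_ge0// addrC subrK.
Qed.

(** As long as a trajectory from the ball of radius r stays outside that of radius
    eps, V decreases at rate alpha eps from a value at most psi2 r; being
    nonnegative, V limits the duration of this phase. *)
Lemma uniform_weak_attractivity (V : X -> R) (eps r : R) :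
  noncoercive_lyapunov S V -> 0 < eps -> 0 < r ->
  exists2 tau : R, 0 < tau & forall x d, dist S d -> `|x| <= r ->
    exists2 t, 0 <= t <= tau & `|flow S t x d| <= eps.
Proof.
move=> [cV V0 V00 [psi2 [alpha [[Kpsi2 _] Kalpha Vpsi2 dV]]]] eps0 r0.
have aeps := classK_gt0 Kalpha eps0.
have psi2r := classK_gt0 Kpsi2 r0.
exists (psi2 r / alpha eps + 1); first by rewrite ltr_wpDl// divr_ge0// ltW.
set tau := _ + 1 => x d Dd xr; apply: contrapT => far.
have tau0 : 0 <= tau by rewrite addr_ge0// divr_ge0// ltW.
have Vx : V x <= psi2 r.
  have [->|x0] := eqVneq x 0; first by rewrite V00 ltW.
  have /andP[_ /le_trans] := Vpsi2 _ x0; apply.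
  exact: (classK_le Kpsi2).
have := lyapunov_decay (c := alpha eps) (x := x) cV dV Dd (lexx 0) tau0.
rewrite flow0// subr0 => Vtau.
have : V (flow S tau x d) <= V x - alpha eps * tau.
  apply: Vtau => u /andP[u0 utau].
  apply: (classK_le Kalpha (ltW eps0)).
  rewrite leNgt; apply/negP => ueps; apply: far; exists u; last exact: ltW.
  by rewrite u0 ltW.
rewrite /tau mulrDr mulrCA divff ?gt_eqF// !mulr1.
have := V0 (flow S (psi2 r / alpha eps + 1) x d); lra.
Qed.

(** If a trajectory leaves the eps-ball at time t, the robustness of the
    equilibrium over unit time keeps it outside a del-ball during [t - 1, t], and
    this alone costs V at least alpha del; hence V was at least alpha del at the
    start, which continuity of V at 0 excludes near 0. *)
Lemma uniform_stability (V : X -> R) (eps : R) :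
  noncoercive_lyapunov S V -> robust_equilibrium0 S -> 0 < eps ->
  exists2 del : R, 0 < del & forall x d t, dist S d -> 0 <= t -> `|x| <= del ->
    `|flow S t x d| <= eps.
Proof.
move=> [cV V0 V00 [_ [alpha [_ Kalpha _ dV]]]] [_ rep] eps0.
have [del1 del10 hdel1] := rep eps 1 eps0 ltr01.
have adel1 := classK_gt0 Kalpha del10.
have [del2 /= del20 hdel2] : exists2 del2 : R, 0 < del2 &
    forall x : X, `|x| < del2 -> V x < alpha del1.
  have /cvgrPdist_lt/(_ _ adel1)/nbhs_ballP[del2 /= del20 Vdel2] := cV 0.
  exists del2 => // x xdel2; have /= := Vdel2 x.
  rewrite V00 sub0r normrN ger0_norm//; apply.
  by rewrite -ball_normE/= sub0r normrN.
exists (Num.min del1 (del2 / 2)); first by rewrite lt_min del10 divr_gt0.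
move=> x d t Dd t0; rewrite le_min => /andP[xdel1 xdel2].
rewrite leNgt; apply/negP => teps.
have out u : 0 <= u <= t -> t - u <= 1 -> del1 < `|flow S u x d|.
  move=> /andP[u0 ut] tu1; rewrite ltNge; apply/negP => udel1.
  move: teps; rewrite (flow_cocycleB x Dd u0 ut) ltNge hdel1 ?subr_ge0 ?ut//.
  exact: dist_shift.
have t1 : 1 < t.
  rewrite ltNge; apply/negP => t1.
  have := out 0; rewrite lexx t0 subr0 flow0// => /(_ erefl t1).
  by rewrite ltNge xdel1.
have t10 : 0 <= t - 1 by lra.
have first_phase : V (flow S (t - 1) x d) <= V (flow S 0 x d) - 0 * (t - 1 - 0).
  apply: (lyapunov_decay cV dV) => // u _.
  by case: Kalpha => _ + _ _; apply.
have last_phase : V (flow S t x d) <=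
    V (flow S (t - 1) x d) - alpha del1 * (t - (t - 1)).
  apply: (lyapunov_decay cV dV) => //; first by lra.
  move=> u /andP[tu ut]; apply: (classK_le Kalpha (ltW del10)).
  by apply/ltW/out; [apply/andP; split|]; lra.
have Vx : V x < alpha del1 by apply: hdel2; lra.
move: first_phase last_phase; rewrite flow0// mul0r.
rewrite (_ : t - (t - 1) = 1); last by lra.
by have := V0 (flow S t x d); lra.
Qed.

Lemma uniform_attractivity (V : X -> R) (eps r : R) :
  noncoercive_lyapunov S V -> robust_equilibrium0 S -> 0 < eps -> 0 < r ->
  exists2 tau : R, 0 < tau & forall x d t, dist S d -> tau <= t -> `|x| <= r ->
    `|flow S t x d| <= eps.
Proof.
move=> LV rep eps0 r0.
have [del del0 stab] := uniform_stability LV rep eps0.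
have [tau tau0 attr] := uniform_weak_attractivity LV del0 r0.
exists tau => // x d t Dd taut xr.
have [s /andP[s0 stau] sdel] := attr x d Dd xr.
have st := le_trans stau taut.
rewrite (flow_cocycleB x Dd s0 st); apply: stab => //; last by rewrite subr_ge0.
exact: dist_shift.
Qed.

Lemma uniform_boundedness (V : X -> R) (r : R) :
  noncoercive_lyapunov S V -> robustly_forward_complete S ->
  robust_equilibrium0 S -> 0 < r ->
  exists B : R, forall x d t, dist S d -> 0 <= t -> `|x| <= r ->
    `|flow S t x d| <= B.
Proof.
move=> LV rfc rep r0.
have [tau tau0 attr] := uniform_attractivity LV rep ltr01 r0.
have /= := rfc r tau r0 tau0; set E := (E in ereal_sup E) => Eoo.
exists (Num.max 1 (fine (ereal_sup E))) => x d t Dd t0 xr.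
rewrite le_max; have [taut|ttau] := leP tau t; first by rewrite attr.
apply/orP; right.
have Ex : (`|flow S t x d|%:E <= ereal_sup E)%E.
  apply: ereal_sup_ubound; exists `|flow S t x d| => //.
  by exists x, t, d; split=> //; rewrite t0 ltW.
have /fineK Efin : ereal_sup E \is a fin_num.
  by rewrite fin_real// Eoo andbT (lt_le_trans _ Ex)// ltNyr.
by rewrite -lee_fin Efin.
Qed.
End lyapunov.

(** * Majorization by a function of class KL *)

Section KL_majorant.
Context {R : realType}.

Definition clamp (x : R) : R := Num.max 0 (Num.min 1 x).

Lemma clamp_ge0 x : 0 <= clamp x.
Proof. by rewrite /clamp le_max lexx. Qed.

Lemma clamp_le1 x : clamp x <= 1.
Proof. by rewrite /clamp ge_max ler01 ge_min lexx. Qed.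

Lemma clamp_ge1 x : 1 <= x -> clamp x = 1.
Proof. by move=> x1; rewrite /clamp min_l// max_r. Qed.

Lemma clamp_le0 x : x <= 0 -> clamp x = 0.
Proof. by move=> x0; rewrite /clamp max_l// ge_min x0 orbT. Qed.

Lemma clamp_id x : 0 <= x <= 1 -> clamp x = x.
Proof. by move=> /andP[x0 x1]; rewrite /clamp min_r// max_r. Qed.

Lemma clamp_le x y : x <= y -> clamp x <= clamp y.
Proof.
move=> xy; rewrite {1}/clamp ge_max clamp_ge0 /clamp le_max le_min !ge_min lexx/=.
by rewrite xy !orbT.
Qed.

Lemma clamp_lipschitz x y : x <= y -> clamp y <= clamp x + (y - x).
Proof.
move=> xy; have [x1|x1] := leP 1 x.
  by rewrite (clamp_ge1 x1) (le_trans (clamp_le1 y))//; lra.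
have [y1|y1] := leP 1 y.
  rewrite (clamp_ge1 y1); have [x0|x0] := leP x 0; first by rewrite clamp_le0//; lra.
  by rewrite (@clamp_id x) ?(ltW x0) ?(ltW x1)//; lra.
have [y0|y0] := leP y 0.
  by rewrite (clamp_le0 y0) addr_ge0 ?clamp_ge0// subr_ge0.
rewrite (@clamp_id y) ?(ltW y0) ?(ltW y1)//.
have [x0|x0] := leP x 0; first by rewrite clamp_le0//; lra.
by rewrite (@clamp_id x) ?(ltW x0) ?(ltW x1)//; lra.
Qed.

(** The index i stands for a pair of a trajectory and a time tau i: rho i is the
    norm of the initial state and a i the norm of the state at time tau i. The
    last three assumptions are boundedness, stability and attractivity, all
    uniform. *)
Context {I : Type} (D : set I) (rho tau a : I -> R).
Context (rho_ge0 : forall i, D i -> 0 <= rho i) (a_ge0 : forall i, D i -> 0 <= a i).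
Context (a_bounded : forall r : R, exists B : R,
  forall i, D i -> rho i <= r -> a i <= B).
Context (a_small : forall eps : R, 0 < eps ->
  exists2 del : R, 0 < del & forall i, D i -> rho i <= del -> a i <= eps).
Context (a_vanishes : forall eps r : R, 0 < eps ->
  exists T : R, forall i, D i -> rho i <= r -> T <= tau i -> a i <= eps).

(** A piecewise affine cut-off in place of the indicator function of
    rho i <= r, t <= tau i. It is 1 there (if rho i > 0) and vanishes unless
    rho i < 2 r and t < tau i + 1. The first factor is written with r in the
    numerator so that it makes sense, and is 0, at r = 0. *)
Definition cutoff (i : I) (r t : R) : R :=
  clamp (2 * r / rho i - 1) * clamp (1 + tau i - t).

(** The value 0 is added so that the supremum is taken over a nonempty set even
    when D is empty. *)
Definition envelope (r t : R) : R :=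
  sup ([set 0] `|` [set a i * cutoff i r t | i in D]).

Lemma cutoff_le1 i r t : cutoff i r t <= 1.
Proof. by rewrite mulr_ile1// ?clamp_ge0// clamp_le1. Qed.

Lemma cutoff_eq0 i r t : D i -> 2 * r <= rho i -> cutoff i r t = 0.
Proof.
move=> Di ri; rewrite /cutoff clamp_le0 ?mul0r// subr_le0.
have := rho_ge0 Di; rewrite le_eqVlt => /predU1P[<-|rho0].
  by rewrite invr0 mulr0.
by rewrite ler_pdivrMr// mul1r.
Qed.

Lemma envelope_le r t c : 0 <= c ->
  (forall i, D i -> a i * cutoff i r t <= c) -> envelope r t <= c.
Proof.
move=> c0 ac; apply: ge_sup; first by exists 0; left.
by move=> _ [->//|[i Di <-]]; exact: ac.
Qed.

Lemma envelope_le_support r t c : 0 <= c ->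
  (forall i, D i -> rho i <= 2 * r -> t - 1 <= tau i -> a i <= c) ->
  envelope r t <= c.
Proof.
move=> c0 ac; apply: envelope_le => // i Di.
have [ri|ri] := leP (2 * r) (rho i); first by rewrite cutoff_eq0 ?mulr0.
have [ti|ti] := leP (t - 1) (tau i); last first.
  by rewrite /cutoff (@clamp_le0 (_ - t)) ?mulr0//; lra.
apply: le_trans (ac i Di (ltW ri) ti).
by rewrite ler_piMr ?a_ge0// cutoff_le1.
Qed.

Lemma envelope_has_ubound r t :
  has_ubound ([set 0] `|` [set a i * cutoff i r t | i in D]).
Proof.
have [B aB] := a_bounded (2 * r); exists `|B| => _ [->//|[i Di <-]].
have [ri|ri] := leP (2 * r) (rho i); first by rewrite cutoff_eq0 ?mulr0.
apply: le_trans (le_trans (aB i Di (ltW ri)) (ler_norm _)).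
by rewrite ler_piMr ?a_ge0// cutoff_le1.
Qed.

Lemma le_envelope i r t : D i -> a i * cutoff i r t <= envelope r t.
Proof.
by move=> Di; apply: ub_le_sup (envelope_has_ubound r t) _ _; right; exists i.
Qed.

Lemma envelope_ge0 r t : 0 <= envelope r t.
Proof. by apply: ub_le_sup (envelope_has_ubound r t) _ _; left. Qed.

Lemma a_eq0 i : D i -> rho i = 0 -> a i = 0.
Proof.
move=> Di rho0; apply/le_anti; rewrite a_ge0// andbT.
apply/ler_addgt0Pr => e e0; rewrite add0r.
have [del del0] := a_small e0; apply=> //; rewrite rho0; exact: ltW.
Qed.

Lemma le_envelope_diag i : D i -> a i <= envelope (rho i) (tau i).
Proof.
move=> Di; have := rho_ge0 Di; rewrite le_eqVlt => /predU1P[rho0|rho0].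
  by rewrite a_eq0// envelope_ge0.
apply: le_trans (le_envelope _ _ Di).
rewrite /cutoff mulfK ?gt_eqF// addrK !clamp_ge1 ?mulr1//; lra.
Qed.

Lemma envelope_nondecreasing r r' t :
  r <= r' -> envelope r t <= envelope r' t.
Proof.
move=> rr'; apply: envelope_le => [|i Di]; first exact: envelope_ge0.
apply: le_trans (le_envelope r' t Di); rewrite ler_wpM2l ?a_ge0//.
rewrite ler_wpM2r ?clamp_ge0// clamp_le// lerB// ler_wpM2r ?invr_ge0 ?rho_ge0//.
by rewrite ler_pM2l.
Qed.

Lemma envelope_nonincreasing r t t' :
  t <= t' -> envelope r t' <= envelope r t.
Proof.
move=> tt'; apply: envelope_le => [|i Di]; first exact: envelope_ge0.
apply: le_trans (le_envelope r t Di); rewrite ler_wpM2l ?a_ge0//.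
by rewrite ler_wpM2l ?clamp_ge0// clamp_le// lerB.
Qed.

Lemma envelope_lipschitz_time r t t' B : t <= t' -> 0 <= B ->
  (forall i, D i -> rho i <= 2 * r -> a i <= B) ->
  envelope r t <= envelope r t' + B * (t' - t).
Proof.
move=> tt' B0 aB; have BM : 0 <= B * (t' - t) by rewrite mulr_ge0// subr_ge0.
apply: envelope_le => [|i Di]; first by rewrite addr_ge0// envelope_ge0.
have [ri|ri] := leP (2 * r) (rho i).
  by rewrite cutoff_eq0 ?mulr0// addr_ge0// envelope_ge0.
apply: (@le_trans _ _ (a i * cutoff i r t' + B * (t' - t))); last first.
  by rewrite lerD2r le_envelope.
have ww : clamp (1 + tau i - t) <= clamp (1 + tau i - t') + (t' - t).
  apply: (le_trans (@clamp_lipschitz (1 + tau i - t') _ _)); first by rewrite lerB.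
  by rewrite lerD2l; lra.
rewrite /cutoff !mulrA.
apply: (le_trans (ler_wpM2l _ ww)); first by rewrite mulr_ge0 ?a_ge0// clamp_ge0.
rewrite mulrDr lerD2l ler_wpM2r ?subr_ge0//.
apply: le_trans (aB i Di (ltW ri)).
by rewrite ler_piMr ?a_ge0// clamp_le1.
Qed.

(** Only the indices with r < rho i < 2 r' contribute to the increment: the
    cut-off does not change below and vanishes above. In between its slope in the
    first variable is at most 2 / rho i. *)
Lemma envelope_lipschitz_radius q Q r r' t B : 0 < q -> q <= r -> r <= r' ->
  r' <= Q -> 0 <= B -> (forall i, D i -> rho i <= 2 * Q -> a i <= B) ->
  envelope r' t <= envelope r t + B * (2 * (r' - r) / q).
Proof.
move=> q0 qr rr' r'Q B0 aB.
have slope0 : 0 <= 2 * (r' - r) / q.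
  by rewrite divr_ge0 ?(ltW q0)// mulr_ge0// subr_ge0.
have BM := mulr_ge0 B0 slope0.
apply: envelope_le => [|i Di]; first by rewrite addr_ge0// envelope_ge0.
have [ri|ri] := leP (2 * r') (rho i).
  by rewrite cutoff_eq0 ?mulr0// addr_ge0// envelope_ge0.
apply: (@le_trans _ _ (a i * cutoff i r t + B * (2 * (r' - r) / q))); last first.
  by rewrite lerD2r le_envelope.
have := rho_ge0 Di; rewrite le_eqVlt => /predU1P[rho0|rho0].
  by rewrite a_eq0// !mul0r add0r.
have ww : clamp (2 * r' / rho i - 1) <=
    clamp (2 * r / rho i - 1) + 2 * (r' - r) / q.
  have [rir|rri] := leP (rho i) r.
    rewrite [leRHS]addrC (@clamp_ge1 (2 * r / _ - 1)); last first.
      by rewrite lerBrDr ler_pdivlMr//; lra.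
    by rewrite (le_trans (clamp_le1 _))// lerDr.
  apply: (le_trans (@clamp_lipschitz (2 * r / rho i - 1) _ _)).
    by rewrite lerB// ler_wpM2r ?invr_ge0 ?rho_ge0// ler_pM2l.
  rewrite lerD2l [leLHS](_ : _ = 2 * (r' - r) / rho i); last first.
    by rewrite mulrBr mulrBl; lra.
  apply: ler_wpM2l; first by rewrite mulr_ge0// subr_ge0.
  by rewrite lef_pV2 ?posrE//; lra.
rewrite /cutoff ![clamp (2 * _ / _ - 1) * _]mulrC; set w2 := clamp (1 + _ - _).
apply: (@le_trans _ _
  (a i * (w2 * (clamp (2 * r / rho i - 1) + 2 * (r' - r) / q)))).
  by rewrite ler_wpM2l ?a_ge0// ler_wpM2l ?clamp_ge0.
rewrite [w2 * _]mulrDr mulrDr lerD2l mulrA ler_wpM2r//.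
apply: (@le_trans _ _ (a i)); first by rewrite ler_piMr ?a_ge0// clamp_le1.
by apply: aB => //; lra.
Qed.

(** At r = 0 continuity is the stability assumption; at x > 0 the Lipschitz
    estimate is used for radii between x / 2 and 2 x. *)
Lemma envelope_continuous_radius t :
  {within `[0, +oo[, continuous (fun r => envelope r t)}.
Proof.
apply/within_half_line_continuousP => x; rewrite le_eqVlt => /predU1P[<-|x0] e e0.
  have e20 : 0 < e / 2 by rewrite divr_gt0.
  have [del del0 adel] := a_small e20.
  have small r : r < del / 2 -> envelope r t <= e / 2.
    move=> rdel; apply: envelope_le_support; first exact: ltW.
    by move=> i Di ri _; apply: adel => //; lra.
  exists (del / 2); first by rewrite divr_gt0.
  move=> y y0; rewrite subr0 ger0_norm// => ydel.
  have := small y ydel; have := small 0 (le_lt_trans y0 ydel).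
  have := envelope_ge0 y t; have := envelope_ge0 0 t.
  by rewrite ltr_norml => ? ? ? ?; apply/andP; split; lra.
have [B0 aB0] := a_bounded (2 * (2 * x)); pose B := `|B0| + 1.
have B_gt0 : 0 < B by rewrite /B ltr_wpDl.
have aB i : D i -> rho i <= 2 * (2 * x) -> a i <= B.
  move=> Di /(aB0 i Di); have := ler_norm B0; rewrite /B; lra.
have lip r r' : x / 2 <= r -> r <= r' -> r' <= 2 * x ->
    envelope r' t <= envelope r t + B * (2 * (r' - r) / (x / 2)).
  by move=> ? ? ?; apply: (envelope_lipschitz_radius (Q := 2 * x)) => //; lra.
exists (Num.min (x / 2) (e * x / (4 * B) / 2)).
  by rewrite lt_min !divr_gt0 ?mulr_gt0.
move=> y y0; rewrite lt_min => /andP[yx2 yxe].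
have key u : u = `|y - x| -> B * (2 * u / (x / 2)) < e.
  move=> ->; rewrite (_ : _ * _ = `|y - x| * (4 * B / x)); last first.
    by field; rewrite gt_eqF.
  rewrite -ltr_pdivlMr ?divr_gt0 ?mulr_gt0// invf_div mulrA.
  apply: (lt_le_trans yxe); rewrite ler_pdivrMr// ler_peMr//.
  - by rewrite ltW// divr_gt0 ?mulr_gt0.
  - by lra.
move: yx2; rewrite ltr_norml => /andP[yx2 xy2].
have [xy|yx] := leP x y.
- have := lip x y; have := envelope_nondecreasing t xy.
  have := key (y - x); rewrite ger0_norm ?subr_ge0// => /(_ erefl) ? ?.
  rewrite ler0_norm ?subr_le0// => lipxy.
  by apply: (@le_lt_trans _ _ (B * (2 * (y - x) / (x / 2)))) => //; lra.
- have := lip y x; have := envelope_nondecreasing t (ltW yx).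
  have := key (x - y); rewrite ltr0_norm ?subr_lt0// opprB => /(_ erefl) ? ?.
  rewrite ger0_norm ?subr_ge0// => lipxy.
  by apply: (@le_lt_trans _ _ (B * (2 * (x - y) / (x / 2)))) => //; lra.
Qed.

Lemma envelope_continuous_time r :
  {within `[0, +oo[, continuous (fun t => envelope r t)}.
Proof.
have [B0 aB0] := a_bounded (2 * r); pose B := `|B0| + 1.
have B_gt0 : 0 < B by rewrite /B ltr_wpDl.
have aB i : D i -> rho i <= 2 * r -> a i <= B.
  move=> Di /(aB0 i Di); have := ler_norm B0; rewrite /B; lra.
apply/within_half_line_continuousP => x x0 e e0.
exists (e / B) => [|y y0]; first by rewrite divr_gt0.
rewrite ltr_pdivlMr// mulrC => yx; apply: le_lt_trans yx.
have [xy|yx] := leP x y.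
- rewrite !ger0_norm ?subr_ge0 ?envelope_nonincreasing//.
  by rewrite lerBlDl (envelope_lipschitz_time xy (ltW B_gt0)).
- rewrite (ltr0_norm (x := y - x)) ?subr_lt0// opprB distrC.
  rewrite ger0_norm ?subr_ge0 ?envelope_nonincreasing ?(ltW yx)//.
  by rewrite lerBlDl (envelope_lipschitz_time (ltW yx) (ltW B_gt0)).
Qed.

(** The envelope is only weakly monotone; the term r exp (- t) makes the
    monotonicity strict. *)
Lemma KL_majorant : exists2 beta : R -> R -> R, classKL beta &
  forall i, D i -> a i <= beta (rho i) (tau i).
Proof.
exists (fun r t => envelope r t + r * expR (- t)); last first.
  move=> i Di; rewrite (le_trans (le_envelope_diag Di))// lerDl.
  by rewrite mulr_ge0 ?expR_ge0// rho_ge0.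
split=> [t t0|r r0]; split.
- have clin : {within `[0, +oo[, continuous (fun r : R => r * expR (- t))}.
    by apply: continuous_subspaceT => r; exact: mulrr_continuous.
  by move=> r; apply: (continuousD (@envelope_continuous_radius t r)); exact: clin.
- by move=> r r0; rewrite addr_ge0 ?envelope_ge0// mulr_ge0 ?expR_ge0.
- move=> r s r0 rs; rewrite ler_ltD ?envelope_nondecreasing ?ltW//.
  by rewrite ltr_pM2r ?expR_gt0.
- rewrite mul0r addr0; apply/le_anti; rewrite envelope_ge0 andbT.
  apply: envelope_le_support => // i Di; rewrite mulr0 => rho0 _.
  by rewrite a_eq0//; apply/le_anti; rewrite rho0 rho_ge0.
- have cexp : {within `[0, +oo[, continuous (fun t : R => r * expR (- t))}.
    apply: continuous_subspaceT => t; apply: cvgMr.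
    apply: (@continuous_comp _ _ _ -%R expR); first exact: opp_continuous.
    exact: continuous_expR.
  by move=> t; apply: (continuousD (@envelope_continuous_time r t)); exact: cexp.
- by move=> t t0; rewrite addr_ge0 ?envelope_ge0// mulr_ge0 ?expR_ge0// ltW.
- move=> s t s0 st; rewrite ler_ltD ?envelope_nonincreasing ?ltW//.
  by rewrite ltr_pM2l// ltr_expR ltrN2.
- rewrite -[X in _ --> X](addr0 (0 : R)); apply: cvgD; last first.
    by rewrite -(mulr0 r); apply: cvgMr; exact: cvgr_expR.
  apply/cvgrPdist_le => e e0; have [T aT] := a_vanishes (2 * r) e0.
  near=> t; rewrite sub0r normrN ger0_norm ?envelope_ge0//.
  apply: envelope_le_support => [|i Di ri ti]; first exact: ltW.
  apply: aT => //; apply: le_trans ti; rewrite lerBrDr.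
  by near: t; apply: nbhs_pinfty_ge; rewrite num_real.
Unshelve. all: by end_near. Qed.

End KL_majorant.

Theorem theorem3p5 (R : realType) (X U : normedModType R) (S : system X U) :
  robustly_forward_complete S ->
  robust_equilibrium0 S ->
  (exists V : X -> R, noncoercive_lyapunov S V) ->
  UGAS0 S.
Proof.
move=> rfc rep [V LV].
pose D : set (X * (R -> U) * R) := [set i | dist S i.1.2 /\ 0 <= i.2].
have [||r|eps eps0|eps r eps0|beta KLbeta flow_beta] := @KL_majorant R _ D
  (fun i => `|i.1.1|) (fun i => i.2) (fun i => `|flow S i.2 i.1.1 i.1.2|).
- by move=> i _; exact: normr_ge0.
- by move=> i _; exact: normr_ge0.
- have r0 : 0 < `|r| + 1 by rewrite ltr_wpDl.
  have [B flowB] := uniform_boundedness LV rfc rep r0.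
  exists B => -[[x d] t] [/= Dd t0] xr; apply: flowB => //.
  by have := ler_norm r; lra.
- have [del del0 stab] := uniform_stability LV rep eps0.
  by exists del => // -[[x d] t] [/= Dd t0]; exact: stab.
- have r0 : 0 < `|r| + 1 by rewrite ltr_wpDl.
  have [T T0 attr] := uniform_attractivity LV rep eps0 r0.
  exists T => -[[x d] t] [/= Dd t0] xr Tt; apply: attr => //.
  by have := ler_norm r; lra.
- by exists beta => // x d t Dd t0; apply: (flow_beta (x, d, t)).
Qed.
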